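(* If $S$ is a numerical semigroup and $\{s,s+1\}\subseteq S$, then $T=2S\cup(\{2s+1\}+2S)$ is a Coe-semigroup with a unique odd minimal generator. Moreover, every Coe-semigroup with a unique odd minimal generator is of this form, i.e. equals $2S\cup(\{2s+1\}+2S)$ for some numerical semigroup $S$ and some $s$ with $\{s,s+1\}\subseteq S$.
   Context: $\mathbb{N}=\{0,1,2,\ldots\}$. A numerical semigroup is a subset of $\mathbb{N}$ containing $0$, closed under addition and with finite complement in $\mathbb{N}$. A numerical semigroup $S$ is a Coe-semigroup if $\{x-1,x+1\}\subseteq S$ for every odd $x\in S$. The minimal generators of a numerical semigroup are the elements of its (unique, finite) minimal system of generators as a submonoid of $(\mathbb{N},+)$. Notation: $2S=\{2x\mid x\in S\}$ and $A+B=\{a+b\mid a\in A,\ b\in B\}$. *)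

(* Defs.v *)
From HB Require Import structures.
From mathcomp Require Import all_boot all_order.
From mathcomp Require Import boolp classical_sets functions cardinality.

Set Implicit Arguments.
Unset Strict Implicit.
Unset Printing Implicit Defensive.

Local Open Scope classical_set_scope.

Definition submonoid (M : set nat) : Prop :=
  M 0 /\ forall x y : nat, M x -> M y -> M (x + y).

Definition numerical_semigroup (S : set nat) : Prop :=
  submonoid S /\ finite_set (~` S).

(* For odd [x] the truncated predecessor [x.-1] is the true [x - 1]. *)
Definition Coe_semigroup (S : set nat) : Prop :=
  numerical_semigroup S /\
  forall x : nat, odd x -> S x -> [set x.-1; x.+1] `<=` S.

Definition generated_submonoid (A : set nat) : set nat := smallest submonoid A.

Definition minimal_system_of_generators (S A : set nat) : Prop :=
  generated_submonoid A = S /\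
  forall B : set nat, B `<` A -> generated_submonoid B <> S.

(* A numerical semigroup has exactly one minimal system of generators, so the
   existential below refers to that system. *)
Definition minimal_generator (S : set nat) (x : nat) : Prop :=
  exists A : set nat, minimal_system_of_generators S A /\ A x.

Definition doubling (S : set nat) : set nat := [set (2 * x)%N | x in S].

Definition sumset (A B : set nat) : set nat :=
  [set (a + b)%N | a in A & b in B].

(* Main.v *)
Require Import Defs.
From mathcomp Require Import all_boot all_order.
From mathcomp Require Import boolp classical_sets functions cardinality.
From mathcomp Require Import zify.

(** The minimal system of generators of a submonoid of [nat] is its set of
    atoms: atoms generate by strong induction, and removing an atom from a
    submonoid leaves a submonoid, so every generating set contains all atoms.
    In [2S `|` (2s+1 + 2S)] the least odd element [2s+1] is an atom, and any
    larger odd element is [2s+1] plus a nonzero even element.  Conversely, if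
    [2s+1] is the only odd atom of [T], the odd summand in a decomposition of an
    odd element can be decomposed further until it is [2s+1], so every odd
    element of [T] is [2s+1] plus an even element of [T]. *)

Set Implicit Arguments.
Unset Strict Implicit.
Unset Printing Implicit Defensive.

Local Open Scope classical_set_scope.

Definition atom (M : set nat) (x : nat) : Prop :=
  [/\ M x, 0 < x &
      forall a b : nat, M a -> M b -> 0 < a -> 0 < b -> x <> a + b].

Lemma not_atom_decomp (M : set nat) (x : nat) : M x -> 0 < x -> ~ atom M x ->
  exists a b : nat, [/\ M a, M b, 0 < a, 0 < b & x = a + b].
Proof.
move=> Mx x_gt0 natx; apply: contrapT => nodec; apply: natx; split=> //.
by move=> a b Ma Mb a_gt0 b_gt0 xab; apply: nodec; exists a, b.
Qed.

Lemma generated_atoms (M : set nat) :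
  submonoid M -> generated_submonoid (atom M) = M.
Proof.
move=> subM; apply/seteqP; split=> x.
  by apply; split=> // y [].
elim/ltn_ind: x => x IHx Mx N [subN atomN]; have [N0 ND] := subN.
have [->//|x_gt0] := posnP x.
have [/atomN//|natx] := pselect (atom M x).
have [a [b [Ma Mb a_gt0 b_gt0 xab]]] := not_atom_decomp Mx x_gt0 natx.
rewrite xab; apply: ND.
  by apply: (IHx a _ Ma N); first lia.
by apply: (IHx b) => //; lia.
Qed.

Lemma atom_in_generators (M A : set nat) :
  submonoid M -> generated_submonoid A = M -> atom M `<=` A.
Proof.
move=> [M0 MD] genA x [Mx x_gt0 atx]; apply: contrapT => nAx.
have AM : A `<=` M by rewrite -genA => y Ay N [_]; apply.
have : generated_submonoid A x by rewrite genA.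
(* If [A] misses the atom [x], then [M] without [x] is a submonoid containing [A], so it would
   contain [x]. *)
move=> /(_ [set y | M y /\ y <> x])[]//; split; first split.
- by split=> //; lia.
- move=> a b [Ma nax] [Mb nbx]; split; first exact: MD.
  have [a0|a_gt0] := posnP a; first lia.
  have [b0|b_gt0] := posnP b; first lia.
  by move=> abx; apply: (atx a b).
- by move=> y Ay; split; [exact: AM | move=> yx; rewrite yx in Ay].
Qed.

(** A minimal system contains all atoms, and since these already generate [M] it contains nothing
    else; conversely no proper subset of the atoms generates. *)
Lemma minimal_generatorE (M : set nat) (x : nat) :
  submonoid M -> minimal_generator M x <-> atom M x.
Proof.
move=> subM; split=> [[A [[genA minA] Ax]]|atx].
  have atA := atom_in_generators subM genA.
  apply: contrapT => natx.
  by apply: (minA (atom M)); [split=> // /(_ _ Ax) | exact: generated_atoms].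
exists (atom M); split=> //; split; first exact: generated_atoms.
by move=> B [_ nB] /(atom_in_generators subM).
Qed.

Definition coe_ext (S : set nat) (s : nat) : set nat :=
  doubling S `|` sumset [set (2 * s + 1)%N] (doubling S).

Lemma coe_extP (S : set nat) (s x : nat) : coe_ext S s x <->
  exists2 n, S n & x = 2 * n \/ x = 2 * s + 1 + 2 * n.
Proof.
split=> [[[n Sn <-]|[_ -> [_ [n Sn <-] <-]]]|[n Sn [->|->]]].
- by exists n; [|left].
- by exists n; [|right].
- by left; exists n.
- by right; exists (2 * s + 1) => //; exists (2 * n) => //; exists n.
Qed.

Lemma coe_ext_Coe (S : set nat) (s : nat) : numerical_semigroup S ->
  S s -> S s.+1 -> Coe_semigroup (coe_ext S s).
Proof.
move=> [[S0 SD] finS] Ss Ss1; split; [split; [split|]|].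
- by apply/coe_extP; exists 0; [|left].
- move=> x y /coe_extP[m Sm xm] /coe_extP[n Sn yn]; apply/coe_extP.
  case: xm yn => -> [] ->.
  + by exists (m + n); [exact: SD | left; lia].
  + by exists (m + n); [exact: SD | right; lia].
  + by exists (m + n); [exact: SD | right; lia].
  (* Two odd elements add up to [2 * (2 * s + 1 + m + n)], and [2 * s + 1] lies in [S] as the sum of
     [s] and [s.+1]. *)
  + exists (s + s.+1 + (m + n)); last by left; lia.
    by apply: (SD) (SD _ _ _ _) (SD _ _ _ _).
- pose odds n := 2 * s + 1 + 2 * n.
  (* From [2 * s + 1] on, an even gap of the extension is twice a gap of [S], and an odd one is the
     image of a gap under [odds]; the initial segment absorbs the rest. *)
  apply: (@sub_finite_set _ _
    ((fun n => 2 * n) @` (~` S) `|` odds @` (~` S) `|` `I_(2 * s + 1))).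
    move=> x nTx; have [xs|xs] := ltnP x (2 * s + 1); [by right | left].
    case: (boolP (odd x)) => oddx; [right|left].
      exists ((x - (2 * s + 1))./2); last by rewrite /odds; lia.
      move=> Sx; apply: nTx; apply/coe_extP.
      by exists ((x - (2 * s + 1))./2); [|right; lia].
    exists (x./2); last by lia.
    by move=> Sx; apply: nTx; apply/coe_extP; exists (x./2); [|left; lia].
  rewrite !finite_setU; split; last exact: finite_II.
  by split; exact: finite_image.
- move=> x oddx /coe_extP[n Sn [xn|xn]]; first lia.
  (* The neighbours of [2 * s + 1 + 2 * n] are the doubles of [s + n] and [s.+1 + n]. *)
  move=> _ [->|->]; apply/coe_extP.
    by exists (s + n); [exact: SD | left; lia].
  by exists (s.+1 + n); [exact: SD | left; lia].
Qed.

Lemma coe_ext_odd_atom (S : set nat) (s x : nat) : S 0 ->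
  odd x /\ atom (coe_ext S s) x <-> x = 2 * s + 1.
Proof.
move=> S0; split=> [[oddx [/coe_extP[n Sn xn] x_gt0 atx]]|->].
  case: xn => xn; first lia.
  have [n0|n_gt0] := posnP n; first lia.
  exfalso; apply: (atx (2 * s + 1) (2 * n)) => //; [| |lia|lia].
    by apply/coe_extP; exists 0; [|right; lia].
  by apply/coe_extP; exists n; [|left].
split; first lia.
split; [by apply/coe_extP; exists 0; [|right; lia] | lia |].
(* One of two summands of [2 * s + 1] is odd, hence at least [2 * s + 1], which leaves 0 for the
   other. *)
by move=> a b /coe_extP[m _ am] /coe_extP[n _ bn]; lia.
Qed.

Lemma Coe_unique_odd_atom (T : set nat) (s : nat) : Coe_semigroup T ->
  (forall x, odd x -> atom T x <-> x = 2 * s + 1) ->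
  let S := [set n | T (2 * n)] in
  [/\ numerical_semigroup S, S s, S s.+1 & T = coe_ext S s].
Proof.
move=> [[[T0 TD] finT] coeT] odd_atom S.
have [|Ts _ _] := (odd_atom (2 * s + 1) _).2 erefl; first lia.
have SD x y : S x -> S y -> S (x + y).
  by rewrite /S /= mulnDr; exact: TD.
(* The Coe condition at the odd atom yields [2 * s] and [2 * s.+1] in [T], that is, [s] and [s.+1]
   in [S]. *)
have [Tp Tn] : [/\ T (2 * s + 1).-1 & T (2 * s + 1).+1].
  by split; apply: (coeT (2 * s + 1)) => //=; [lia|left|lia|right].
split.
- split; first by split.
  (* Doubling is injective, so the preimage of the finitely many gaps of [T] is finite. *)
  rewrite (_ : ~` S = (fun n => 2 * n) @^-1` (~` T)) //.
  by apply: finite_preimage => // x y _ _; lia.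
- by rewrite /S /= (_ : 2 * s = (2 * s + 1).-1) //; lia.
- by rewrite /S /= (_ : 2 * s.+1 = (2 * s + 1).+1) //; lia.
apply/seteqP; split=> x; last first.
  by move=> /coe_extP[n Sn [->//|->]]; exact: TD.
elim/ltn_ind: x => x IHx Tx; apply/coe_extP.
case: (boolP (odd x)) => oddx; last first.
  have x2 : x = 2 * x./2 by lia.
  by exists (x./2); [rewrite /S /= -x2 | left].
have [/(odd_atom _ oddx)->|natx] := pselect (atom T x).
  by exists 0; [|right; lia].
have [|a [b [Ta Tb a_gt0 b_gt0 xab]]] := not_atom_decomp Tx _ natx; first lia.
(* As [x] is odd, exactly one summand is odd. Induction writes it as [2 * s + 1 + 2 * n], and half
   of the even summand is added to [n]. *)
wlog odda : a b Ta Tb a_gt0 b_gt0 xab / odd a.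
  move=> wl; case: (boolP (odd a)) => odda; first exact: (wl a b).
  by apply: (wl b a) => //; lia.
have [|n Sn an] := (coe_extP _ _ _).1 (IHx a _ Ta); first lia.
have b2 : b = 2 * b./2 by lia.
by exists (n + b./2); [apply: SD; rewrite // /S /= -b2 | right; lia].
Qed.

Theorem theorem47 :
  (forall (S : set nat) (s : nat),
      numerical_semigroup S -> [set s; s.+1] `<=` S ->
      let T := doubling S `|` sumset [set (2 * s + 1)%N] (doubling S) in
      Coe_semigroup T /\ exists! x : nat, odd x /\ minimal_generator T x) /\
  (forall T : set nat,
      Coe_semigroup T ->
      (exists! x : nat, odd x /\ minimal_generator T x) ->
      exists (S : set nat) (s : nat),
        [/\ numerical_semigroup S,
            [set s; s.+1] `<=` S &
            T = doubling S `|` sumset [set (2 * s + 1)%N] (doubling S)]).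
Proof.
split=> [S s numS sS|T coeT [m [[oddm genm] uniqm]]].
  have coeT : Coe_semigroup (coe_ext S s).
    by apply: coe_ext_Coe => //; apply: sS; [left|right].
  split=> //; have [[subT _] _] := coeT; have [[S0 _] _] := numS.
  exists (2 * s + 1); split.
    have [oddx atx] := (coe_ext_odd_atom s (2 * s + 1) S0).2 erefl.
    by split=> //; apply/minimal_generatorE.
  move=> x [oddx /minimal_generatorE atx].
  by apply/esym/(coe_ext_odd_atom s x S0); split=> //; exact: atx.
have [[subT _] _] := coeT.
have m2 : m = 2 * m./2 + 1 by lia.
have [|numS Ss Ss1 TE] := @Coe_unique_odd_atom T m./2 coeT.
  move=> x oddx; rewrite -m2 -minimal_generatorE//.
  by split=> [genx|->//]; apply/esym/uniqm.
by exists [set n | T (2 * n)], m./2; split=> // _ [->|->].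
Qed.
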